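(* For every finite graph $G$, $\gamma(G)\le \gamma_{\rm MB}(G)\le \gamma_{\rm MB}'(G)$. Moreover, for any integers $r,s,t$ with $2\le r\le s\le t$ there exists a graph $G$ such that $\gamma(G)=r$, $\gamma_{\rm MB}(G)=s$ and $\gamma_{\rm MB}'(G)=t$.
   Context: All graphs are finite and simple. $\gamma(G)$ is the domination number of $G$ (minimum size of a dominating set). The Maker-Breaker domination game on $G$ is played by Dominator and Staller, who alternately select a vertex of $G$ not selected before. Dominator wins if at some point the set of vertices he has selected is a dominating set of $G$; Staller wins otherwise. In the D-game Dominator moves first; in the S-game Staller moves first. $\gamma_{\rm MB}(G)$ is the minimum $k$ such that Dominator has a strategy in the D-game guaranteeing that his selected vertices dominate $G$ after at most $k$ of his moves, whatever Staller does, and $\gamma_{\rm MB}(G)=\infty$ if Dominator has no winning strategy in the D-game; $\gamma_{\rm MB}'(G)$ is defined analogously for the S-game. Inequalities are understood with the convention that $\infty$ is larger than every integer. *)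

(* Defs.v *)
From mathcomp Require Import all_boot.
From mathcomp Require Import boolp.

Set Implicit Arguments.
Unset Strict Implicit.
Unset Printing Implicit Defensive.

Record sgraph := SGraph {
  vertex :> finType;
  adj : rel vertex;
  adj_sym : symmetric adj;
  adj_irrefl : irreflexive adj
}.

Definition dominating (G : sgraph) (D : {set G}) : bool :=
  [forall v, (v \in D) || [exists u in D, adj u v]].

(* The set of all vertices is dominating, so the minimum exists. *)
Definition gamma (G : sgraph) : nat :=
  #|[arg min_(D < [set: G] | dominating D) #|D|]|.

Variant game := DGame | SGame.

(* Whether the move with index i (the first move has index 0) is Dominator's. *)
Definition dominator_turn (g : game) (i : nat) : bool :=
  if g is DGame then ~~ odd i else odd i.

(* Histories list the selected vertices in chronological order. The option
   type lets a strategy exist on the graph without vertices; in general a legal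
   strategy may answer None only when it is not asked to move. *)
Definition strategy (G : sgraph) := seq G -> option G.

Inductive play (G : sgraph) (g : game) (sigma : strategy G) : seq G -> Prop :=
| play_nil : play g sigma [::]
| play_dominator h v :
    play g sigma h -> dominator_turn g (size h) ->
    sigma h = Some v -> v \notin h -> play g sigma (rcons h v)
| play_staller h v :
    play g sigma h -> ~~ dominator_turn g (size h) ->
    v \notin h -> play g sigma (rcons h v).

Definition legal (G : sgraph) (g : game) (sigma : strategy G) : Prop :=
  forall h, play g sigma h -> dominator_turn g (size h) -> size h < #|G| ->
    exists2 v, sigma h = Some v & v \notin h.

Definition dominator_moves (G : sgraph) (g : game) (h : seq G) : seq G :=
  mask (mkseq (dominator_turn g) (size h)) h.

(* Plays are continued until all vertices are selected: what happens after
   Dominator's vertices have become dominating does not affect the condition. *)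
Definition wins_within (G : sgraph) (g : game) (sigma : strategy G) (k : nat) :
    Prop :=
  forall h, play g sigma h -> size h = #|G| ->
    exists2 j, j <= k & dominating [set v in take j (dominator_moves g h)].

Definition dominator_wins_within (G : sgraph) (g : game) (k : nat) : bool :=
  `[< exists2 sigma : strategy G, legal g sigma & wins_within g sigma k >].

(* None stands for infinity. A winning strategy always wins within #|G| moves,
   so there is no such k exactly when Dominator has no winning strategy. *)
Definition MB_number (g : game) (G : sgraph) : option nat :=
  if pselect (exists k, dominator_wins_within G g k) is left ex_k
  then Some (ex_minn ex_k) else None.

Definition gamma_MB : sgraph -> option nat := MB_number DGame.
Definition gamma_MB' : sgraph -> option nat := MB_number SGame.

Definition le_infty (x y : option nat) : bool :=
  match x, y with
  | _, None => true
  | None, Some _ => false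
  | Some m, Some n => m <= n
  end.

(* Main.v *)
Require Import Defs.
From mathcomp Require Import all_boot.
From mathcomp Require Import boolp zify.

Set Implicit Arguments.
Unset Strict Implicit.
Unset Printing Implicit Defensive.

(* An additional move never hurts the player who makes it, so Dominator does at
   least as well when he moves first. For the realization, take a disjoint union of [r]
   friendship graphs, one with [t - r + 1] triangles, one with [s - r + 1]
   triangles and the others with a single triangle. The centers form a minimum
   dominating set. A dominating set that misses the center of a component needs
   a vertex in every triangle of it and a vertex in every other component; so
   Staller takes the center of the largest component, or of the second largest
   one if Dominator starts with the former. Conversely, once Dominator has one
   of these two centers, a vertex of each triangle of the other components is
   enough, which he achieves by pairing two vertices in each, avoiding the
   vertex that Staller may have selected before. *)

(** * Game positions, monotonicity and the pairing strategy *)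

Section Positions.
Variable G : sgraph.
Implicit Types (A D O : {set G}) (k : nat).

Lemma dominatingS A D : A \subset D -> dominating A -> dominating D.
Proof.
move=> sAD /forallP domA; apply/forallP => v.
case/orP: (domA v) => [/(subsetP sAD)-> //|/existsP[u /andP[uA uv]]].
by apply/orP; right; apply/existsP; exists u; rewrite (subsetP sAD).
Qed.

Lemma gamma_min A : dominating A -> gamma G <= #|A|.
Proof.
rewrite /gamma => domA; case: arg_minnP => [|D _]; last exact.
by apply/forallP => v; rewrite inE.
Qed.

Lemma gamma_attained : exists2 A : {set G}, dominating A & #|A| = gamma G.
Proof.
rewrite /gamma; case: arg_minnP => [|D domD _]; last by exists D.
by apply/forallP => v; rewrite inE.
Qed.

(* In [swin k A O] and [dwin k A O], Dominator has selected [A], the set [O] of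
   all selected vertices contains [A], and Dominator can make [A] dominating with
   at most [k] further moves; Staller, respectively Dominator, is to move. *)
Fixpoint swin k A O : bool :=
  dominating A ||
  if k is k'.+1 then
    [exists v, v \notin O] &&
    [forall v, (v \notin O) ==>
       [exists u, (u \notin v |: O) && swin k' (u |: A) (u |: (v |: O))]]
  else false.

Definition dwin k A O : bool :=
  dominating A ||
  if k is k'.+1 then [exists u, (u \notin O) && swin k' (u |: A) (u |: O)]
  else false.

Lemma swin_dominating k A O : dominating A -> swin k A O.
Proof. by case: k => [|k] /= ->. Qed.

Lemma dwin_dominating k A O : dominating A -> dwin k A O.
Proof. by rewrite /dwin => ->. Qed.

(** One form for all [k]: since [dwin 0] is domination, the second alternative adds nothing at
    [k = 0]. The free vertex rules out a vacuous win on a full board. *)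
Lemma swinP k A O :
  reflect (dominating A \/
           (exists v, v \notin O) /\ forall v, v \notin O -> dwin k A (v |: O))
          (swin k A O).
Proof.
have [domA|ndomA] := boolP (dominating A).
  by rewrite swin_dominating //; constructor; left.
case: k => [|k] /=; rewrite /dwin (negbTE ndomA) /=.
  by constructor=> -[//|[[v vO] /(_ v vO)]].
apply: (iffP andP) => [[/existsP exO /forallP winO]|[//|[exO winO]]].
  by right; split=> // v vO; apply: (implyP (winO v)).
split; first exact/existsP.
by apply/forallP => v; apply/implyP/winO.
Qed.

Lemma swinS k A O O' : O' \subset O -> swin k A O -> swin k A O'.
Proof.
elim: k A O O' => [//|k IHk] A O O' sO' /swinP[/swin_dominating->//|[[w wO] winO]].
apply/swinP; have [|ndomA] := boolP (dominating A); [by left | right].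
split=> [|v vO']; first by exists w; apply: contra wO; apply/subsetP.
(* If Staller's move [v] already lies in [O], Dominator answers as if it had been the free vertex
   [w]. *)
have [x xO sx] : exists2 x, x \notin O & v |: O' \subset x |: O.
  have [vO|vO] := boolP (v \in O); last by exists v; rewrite ?setUS.
  by exists w; rewrite // subUset sub1set !inE vO orbT subsetU ?sO' ?orbT.
move: (winO x xO); rewrite /dwin (negbTE ndomA) /=.
case/existsP=> u /andP[uO winu]; apply/existsP; exists u.
by rewrite (contra (subsetP sx u)) // (IHk _ _ _ _ winu) // setUS.
Qed.

(** Dominator imagines some move [v] of Staller, plays the answer to it, and then frees [v] again by
    [swinS]. *)
Lemma swin_dwin k A O : swin k A O -> dwin k A O.
Proof.
case/swinP=> [/dwin_dominating-> //|[[v vO] /(_ v vO)]].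
rewrite /dwin; case: (dominating A) => //=; case: k => // k /existsP[u].
rewrite !inE negb_or => /andP[/andP[_ uO] winu]; apply/existsP; exists u.
by rewrite uO (swinS _ winu) // setUS // subsetUr.
Qed.

(* As Staller may select arbitrary vertices, any play of the winning strategy
   produces such a set. *)
Lemma dwin_dominating_set k A O : A \subset O -> dwin k A O ->
  exists D, [/\ dominating D, D :&: O \subset A & #|D| <= #|A| + k].
Proof.
elim: k A O => [|k IHk] A O sAO /orP[domA|//];
  try by exists A; rewrite subsetIl leq_addr.
(* Staller's moves are skipped, so every vertex added to [A] is Dominator's and lies outside [O]. *)
case/existsP=> u /andP[uO /swin_dwin winu].
have [|D [domD sD leD]] := IHk _ _ _ winu; first by rewrite setUS.
exists D; split=> //; last first.
  rewrite (leq_trans leD) // addnS -addSn leq_add2r.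
  by rewrite cardsU1 -add1n leq_add2r leq_b1.
apply/subsetP => x /setIP[xD xO].
have := subsetP sD x; rewrite !inE xD xO orbT => /(_ isT).
by case: eqP => // xu; rewrite -xu xO in uO.
Qed.

Lemma swin_leq k k' A O : k <= k' -> swin k A O -> swin k' A O.
Proof.
elim: k k' A O => [|k IHk] [|k'] A O //; first by move=> _ /orP[/= ->|].
rewrite ltnS => lek /swinP[/swin_dominating->//|[exO winO]]; apply/swinP; right.
split=> // v /winO /orP[/dwin_dominating->//|/existsP[u /andP[uO winu]]].
by apply/orP; right; apply/existsP; exists u; rewrite uO (IHk k').
Qed.

Lemma dwin_leq k k' A O : k <= k' -> dwin k A O -> dwin k' A O.
Proof.
case: k k' => [|k] [|k'] //; try by move=> _ /orP[/dwin_dominating->|].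
rewrite ltnS => lek /orP[/dwin_dominating->//|].
by case/existsP=> u /andP[uO /(swin_leq lek) winu]; apply/orP; right;
  apply/existsP; exists u; rewrite uO.
Qed.

Lemma pairing_swin (J : finType) (f : J -> bool -> G) (S : {set J}) A O :
    (forall j j' b b', f j b = f j' b' -> j = j' /\ b = b') ->
    (forall j b, j \in S -> f j b \notin O) ->
    (forall D, A \subset D -> (forall j, j \in S -> exists b, f j b \in D) ->
       dominating D) ->
  swin #|S| A O.
Proof.
move=> f_inj; move: {2}#|S| (erefl #|S|) => n.
elim: n S A O => [|n IHn] S A O cardS freeS domS.
  apply/swin_dominating/domS => // j; move/eqP: cardS.
  by rewrite cards_eq0 => /eqP->; rewrite inE.
have [j0 j0S] : exists j, j \in S by apply/set0Pn; rewrite -card_gt0 cardS.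
rewrite cardS; apply/swinP; right.
split=> [|v vO]; first by exists (f j0 true); apply: freeS.
(* Dominator answers in the pair containing [v], or in any open pair if there is none; the remaining
   pairs stay free. *)
have [j [b [jS fjv freev]]] : exists j b, [/\ j \in S, f j b != v &
    forall i c, i \in S -> i != j -> f i c != v].
  have [/existsP[j /existsP[b /andP[jS /eqP fjv]]]|nfv] :=
      boolP [exists j, [exists b, (j \in S) && (f j b == v)]].
    exists j, (~~ b); split=> // [|i c _]; rewrite -fjv; last first.
      by apply: contra => /eqP/f_inj[->].
    by apply/eqP => /f_inj[_]; case: b {fjv}.
  have nf i c : i \in S -> f i c != v.
    move=> iS; apply: contra nfv => fv; apply/existsP; exists i.
    by apply/existsP; exists c; rewrite iS.
  by exists j0, true; split=> // [|i c iS _]; apply: nf.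
apply/orP; right; apply/existsP; exists (f j b).
rewrite !inE negb_or fjv freeS //=.
have cardj : #|S :\ j| = n by move: (cardsD1 j S); rewrite jS cardS => -[].
rewrite -cardj; apply: IHn => // [i c|D sD hitD].
  rewrite !inE => /andP[ij iS]; rewrite !negb_or freev // freeS // !andbT.
  by apply: contra ij => /eqP/f_inj[->].
apply: domS => [|i iS]; first by apply: subset_trans sD; apply: subsetUr.
have [->|ij] := eqVneq i j; first by exists b; rewrite (subsetP sD) ?setU11.
by apply: hitD; rewrite !inE ij.
Qed.

End Positions.

(** * Equivalence of strategies on histories with winning positions *)

Section Strategies.
Variables (G : sgraph) (g : game) (k : nat).
Implicit Types (h : seq G) (sigma : strategy G).

Lemma dominator_turnS i : dominator_turn g i.+1 = ~~ dominator_turn g i.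
Proof. by case: g => //=; rewrite negbK. Qed.

Lemma dominator_moves_rcons h v : dominator_moves g (rcons h v) =
  if dominator_turn g (size h) then rcons (dominator_moves g h) v
  else dominator_moves g h.
Proof.
rewrite /dominator_moves size_rcons mkseqS mask_rcons ?size_mkseq //.
by case: dominator_turn; rewrite /= ?cats1 ?cats0.
Qed.

Lemma play_uniq sigma h : play g sigma h -> uniq h.
Proof. by elim=> // {}h v _ IHh _ => [_|] vh; rewrite rcons_uniq vh. Qed.

Lemma setU1_rcons h v : [set x in rcons h v] = v |: [set x in h].
Proof. by apply/setP => x; rewrite !inE mem_rcons inE. Qed.

Lemma unselected_exists h : size h < #|G| -> exists v, v \notin h.
Proof.
move=> lth; apply/existsP; apply: contraLR lth; rewrite negb_exists -leqNgt.
move=> /forallP allh; rewrite (leq_trans _ (card_size h)) //.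
by apply/subset_leq_card/subsetP => x _; move: (allh x); rewrite negbK.
Qed.

Lemma full_play_mem sigma h v :
  play g sigma h -> size h = #|G| -> v \in h.
Proof.
move=> /play_uniq uh sizeh; have := subset_cardP _ (subset_predT [in h]).
by move=> ->//; rewrite (card_uniqP uh).
Qed.

(* Only Dominator's first [k] moves count, so that the position stays
   meaningful after they have been used up. *)
Definition counted h : {set G} := [set v in take k (dominator_moves g h)].

Definition winning h : bool :=
  (if dominator_turn g (size h) then @dwin G else @swin G)
    (k - size (dominator_moves g h)) (counted h) [set v in h].

Lemma winning_dominating h : dominating (counted h) -> winning h.
Proof.
rewrite /winning; case: ifP => _; by [apply: dwin_dominating | apply: swin_dominating].
Qed.

Lemma counted_staller h v : ~~ dominator_turn g (size h) ->
  counted (rcons h v) = counted h.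
Proof. by rewrite /counted dominator_moves_rcons => /negbTE->. Qed.

Lemma counted_lt h v : dominator_turn g (size h) ->
  size (dominator_moves g h) < k -> counted (rcons h v) = v |: counted h.
Proof.
rewrite /counted dominator_moves_rcons => -> ltk.
by rewrite !take_oversize ?size_rcons ?setU1_rcons // ltnW.
Qed.

Lemma counted_geq h v : k <= size (dominator_moves g h) ->
  counted (rcons h v) = counted h.
Proof.
rewrite /counted dominator_moves_rcons; case: ifP => // _ lek.
by rewrite -cats1 takel_cat.
Qed.

Lemma countedS h v : counted h \subset counted (rcons h v).
Proof.
have [turn|turn] := boolP (dominator_turn g (size h)); last first.
  by rewrite counted_staller.
have [lek|ltk] := leqP k (size (dominator_moves g h)); first by rewrite counted_geq.
by rewrite counted_lt ?subsetUr.
Qed.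

(** Backward induction from the full plays, on the number of unselected vertices. *)
Lemma strategy_winning sigma h : legal g sigma -> wins_within g sigma k ->
  play g sigma h -> winning h.
Proof.
move=> sigma_legal sigma_wins.
have [n] := ubnP (#|G| - size h); elim: n h => // n IHn h len play_h.
have [domh|ndomh] := boolP (dominating (counted h)); first exact: winning_dominating.
have lth : size h < #|G|.
  rewrite ltn_neqAle -(card_uniqP (play_uniq play_h)) max_card andbT.
  rewrite (card_uniqP (play_uniq play_h)); apply: contra ndomh => /eqP sizeh.
  have [j lejk] := sigma_wins h play_h sizeh; apply: dominatingS.
  apply/subsetP => x; rewrite !inE -(subnKC lejk) takeD mem_cat => -> //.
have IHv v : play g sigma (rcons h v) -> winning (rcons h v).
  by apply: IHn; rewrite size_rcons; lia.
have [turn|turn] := boolP (dominator_turn g (size h)).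
  have [v sigma_v vh] := sigma_legal h play_h turn lth.
  have := IHv v (play_dominator play_h turn sigma_v vh).
  rewrite /winning size_rcons dominator_turnS turn /= setU1_rcons.
  have [lek|ltk] := leqP k (size (dominator_moves g h)).
    (* With all [k] moves used up, [swin 0] would make [counted h] dominating. *)
    rewrite counted_geq // dominator_moves_rcons turn size_rcons.
    by move/eqP: (leqW lek) => -> /=; rewrite orbF (negbTE ndomh).
  rewrite counted_lt // dominator_moves_rcons turn size_rcons => winv.
  rewrite /dwin -(subnSK ltk); apply/orP; right.
  by apply/existsP; exists v; rewrite inE vh.
rewrite /winning (negbTE turn); apply/swinP; right.
split=> [|v]; first by have [v vh] := unselected_exists lth; exists v; rewrite inE.
rewrite inE => vh; have := IHv v (play_staller play_h turn vh).
rewrite /winning size_rcons dominator_turnS turn setU1_rcons counted_staller //.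
by rewrite dominator_moves_rcons (negbTE turn).
Qed.

(** The fallback keeps the strategy legal where no winning move exists. *)
Definition winning_strategy : strategy G := fun h =>
  if [pick u | (u \notin h) && winning (rcons h u)] is Some u then Some u
  else [pick u | u \notin h].

Lemma winning_strategy_legal : legal g winning_strategy.
Proof.
move=> h _ _ /unselected_exists[v vh]; rewrite /winning_strategy.
case: pickP => [u /andP[uh _]|_]; first by exists u.
by case: pickP => [u uh|/(_ v)]; [exists u | rewrite vh].
Qed.

Lemma play_winning h : winning [::] -> play g winning_strategy h -> winning h.
Proof.
move=> win0; elim=> // {}h v _ winh turn => [sigma_v vh|vh];
  have [domh|ndomh] := boolP (dominating (counted h));
  try by apply: winning_dominating; apply: dominatingS (countedS h v) domh.
- move: sigma_v; rewrite /winning_strategy.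
  case: pickP => [u /andP[_ winu] [<-]//|nowin].
  move: winh; rewrite /winning turn /dwin (negbTE ndomh) /=.
  case ek: (k - _) => [//|k'] /existsP[u /andP[]].
  rewrite inE => uh winu; have := nowin u.
  rewrite uh /winning size_rcons dominator_turnS turn /=.
  rewrite setU1_rcons counted_lt //; last by rewrite -subn_gt0 ek.
  by rewrite dominator_moves_rcons turn size_rcons subnS ek winu.
move: winh; rewrite /winning (negbTE turn) => /swinP[|[_ /(_ v)]].
  by rewrite (negbTE ndomh).
rewrite inE size_rcons dominator_turnS turn setU1_rcons counted_staller //.
by rewrite dominator_moves_rcons (negbTE turn); apply.
Qed.

Lemma winning_strategy_wins :
  winning [::] -> wins_within g winning_strategy k.
Proof.
move=> win0 h play_h sizeh; exists k => //.
have := play_winning win0 play_h; rewrite /winning.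
(* On a full board nobody can move, so a winning position must already be dominating. *)
have full v : v \in [set x in h] by rewrite inE (full_play_mem v play_h).
case: ifP => _; last by case/swinP=> // -[[v]]; rewrite full.
case/orP=> //; case: (k - _) => // k' /existsP[v].
by rewrite full.
Qed.

Lemma dominator_wins_winning : dominator_wins_within G g k = winning [::].
Proof.
apply/asboolP/idP => [[sigma sigma_legal sigma_wins]|win0].
  exact: strategy_winning sigma_legal sigma_wins (play_nil g sigma).
by exists winning_strategy;
  [exact: winning_strategy_legal | exact: winning_strategy_wins].
Qed.

End Strategies.

(** * Comparison of the three numbers *)

Lemma dominator_wins_DGame (G : sgraph) k :
  dominator_wins_within G DGame k = dwin k (@set0 G) set0.
Proof. by rewrite dominator_wins_winning /winning /counted /= subn0 set_nil. Qed.

Lemma dominator_wins_SGame (G : sgraph) k :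
  dominator_wins_within G SGame k = swin k (@set0 G) set0.
Proof. by rewrite dominator_wins_winning /winning /counted /= subn0 set_nil. Qed.

Lemma MB_number_eq (G : sgraph) g k : dominator_wins_within G g k ->
  (forall m, dominator_wins_within G g m -> k <= m) -> MB_number g G = Some k.
Proof.
rewrite /MB_number => wink mink; case: pselect => [ex_k|]; last by case; exists k.
by case: ex_minnP => m winm minm; congr Some; apply/eqP; rewrite eqn_leq minm ?mink.
Qed.

Lemma gamma_le_MB (G : sgraph) : le_infty (Some (gamma G)) (gamma_MB G).
Proof.
rewrite /gamma_MB /MB_number; case: pselect => // ex_k /=.
case: ex_minnP => k; rewrite dominator_wins_DGame => wink _.
have [D [domD _ leD]] := dwin_dominating_set (subxx _) wink.
by apply: leq_trans (gamma_min domD) _; rewrite cards0 in leD.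
Qed.

Lemma MB_le_MB' (G : sgraph) : le_infty (gamma_MB G) (gamma_MB' G).
Proof.
rewrite /gamma_MB /gamma_MB' /MB_number.
case: (pselect (exists k, dominator_wins_within G SGame k)) => [exS|]; last first.
  by case: pselect.
case: (ex_minnP exS) => k; rewrite dominator_wins_SGame => /swin_dwin wink _.
rewrite -dominator_wins_DGame in wink.
case: pselect => [exD|]; last by case; exists k.
by case: ex_minnP => m _ /(_ k wink).
Qed.

(** * Disjoint unions of friendship graphs *)

Section Windmills.
Variables (I P : finType) (comp : P -> I).

Definition windmill_adj (u v : I + P * bool) : bool :=
  match u, v with
  | inl i, inr (j, _) | inr (j, _), inl i => comp j == i
  | inr (j, b), inr (j', b') => (j == j') && (b != b')
  | inl _, inl _ => false
  end.

Lemma windmill_adj_sym : symmetric windmill_adj.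
Proof. by move=> [i|[j b]] [i'|[j' b']] //=; rewrite eq_sym (eq_sym b). Qed.

Lemma windmill_adj_irrefl : irreflexive windmill_adj.
Proof. by move=> [i|[j b]] //=; rewrite !eqxx. Qed.

(* The disjoint union over [i : I] of the friendship graphs with center [inl i]
   and one triangle [inl i, inr (j, true), inr (j, false)] for every [j] in the
   fibre of [comp] at [i]. *)
Definition windmill : sgraph := SGraph windmill_adj_sym windmill_adj_irrefl.

Implicit Types (D : {set windmill}) (i : I) (j : P).

Definition center i : windmill := inl i.
Definition blade j (b : bool) : windmill := inr (j, b).

Definition fiber i : {set P} := [set j | comp j == i].

Lemma component_hit D i : dominating D ->
  center i \in D \/ exists j b, comp j = i /\ blade j b \in D.
Proof.
move/forallP/(_ (center i))/orP=> [|/existsP[[i'|[j b]] /andP[uD]]] //=.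
  by left.
by move/eqP; right; exists j, b.
Qed.

Lemma triangle_hit D j : dominating D ->
  center (comp j) \in D \/ exists b, blade j b \in D.
Proof.
move/forallP/(_ (blade j true))/orP=> [|/existsP[[i'|[j' b]] /andP[uD]]] /=.
- by right; exists true.
- by move/eqP=> ->; left.
by case/andP=> /eqP<- _; right; exists b.
Qed.

Lemma card_dominating D : dominating D -> #|I| <= #|D|.
Proof.
move=> domD.
pose hub (v : windmill) := match v with inl i => i | inr (j, _) => comp j end.
apply: leq_trans (leq_imset_card hub (mem D)); apply/subset_leq_card/subsetP => i _.
by apply/imsetP; case: (component_hit i domD) => [|[j [b [<-]]]] iD;
  [exists (center i) | exists (blade j b)].
Qed.

Lemma card_dominating_avoiding D i : dominating D -> center i \notin D ->
  #|I|.-1 + #|fiber i| <= #|D|.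
Proof.
move=> domD iD.
(* Contracts each other component and each blade pair of component [i] to a point; the image of [D]
   must contain all these points. *)
pose part (v : windmill) : I + P := match v with
  | inl i' => inl i'
  | inr (j, _) => if comp j == i then inr j else inl (comp j) end.
have -> : #|I|.-1 + #|fiber i| = #|[set inl i' | i' in [set~ i]] :|:
    [set inr j | j in fiber i] : {set I + P}|.
  rewrite cardsU !card_imset; try by move=> ? ? [].
  rewrite cardsC1 (_ : _ :&: _ = set0) ?cards0 ?subn0 //.
  by apply/setP => x; rewrite !inE; apply/andP => -[/imsetP[? _ ->] /imsetP[]].
apply: leq_trans (leq_imset_card part (mem D)); apply/subset_leq_card/subsetP => x.
case/setUP=> /imsetP[].
  move=> i'; rewrite !inE => ii' ->; apply/imsetP.
  case: (component_hit i' domD) => [|[j [b [ji']]]] vD; first by exists (center i').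
  by exists (blade j b); rewrite //= ji' (negbTE ii').
move=> j; rewrite inE => /eqP ji ->; apply/imsetP.
case: (triangle_hit j domD) => [|[b bD]]; first by rewrite ji (negbTE iD).
by exists (blade j b); rewrite //= ji eqxx.
Qed.

Lemma gamma_windmill : gamma windmill = #|I|.
Proof.
apply/eqP; rewrite eqn_leq; apply/andP; split; last first.
  by have [D /card_dominating leD <-] := gamma_attained windmill.
have <- : #|[set center i | i in I]| = #|I| by rewrite card_imset // => ? ? [].
apply: gamma_min; apply/forallP => -[i|[j b]]; apply/orP.
  by left; apply: imset_f.
by right; apply/existsP; exists (center (comp j)); rewrite imset_f //= eqxx.
Qed.

Hypothesis comp_surj : forall i, exists j, comp j = i.

(* Dominator holds [center i] and Staller has selected [v]; when [v] is not
   a center, Dominator pairs the two other vertices of its triangle. *)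
Lemma windmill_swin i (v : windmill) : center i != v ->
  swin #|~: fiber i| [set center i] [set center i; v].
Proof.
move=> iv.
pose f j b := if blade j b == v then center (comp j) else blade j b.
apply: (pairing_swin (f := f)) => [j j' b b'|j b|D].
- rewrite /f; case: eqP => [<-|_]; case: eqP => [|_] //.
    by case=> -> ->.
  by case=> -> ->.
- rewrite !inE /f => ji; case: (blade j b =P v) => [<-|/eqP jv]; last first.
    by rewrite negb_or jv.
  by rewrite orbF; apply: contra ji => /eqP[->].
rewrite sub1set => iD hit; apply/forallP.
(* Every other component has a triangle, and the vertex held in its pair is the center or adjacent
   to it. *)
have dom_center i' : [exists u in D, adj u (center i')] || (center i' \in D).
  have [->|ii'] := eqVneq i' i; first by rewrite iD orbT.
  have [j ji'] := comp_surj i'; have [|b] := hit j; first by rewrite !inE ji'.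
  rewrite /f; case: ifP => _ bD; first by rewrite -ji' bD orbT.
  by apply/orP; left; apply/existsP; exists (blade j b); rewrite bD /= ji' eqxx.
have dom_blade j b b' : blade j b \in D ->
    (blade j b' \in D) || [exists u in D, adj u (blade j b')].
  have [->->//|bb' bD] := eqVneq b b'; apply/orP; right.
  by apply/existsP; exists (blade j b); rewrite bD /= eqxx.
have dom_comp j b : center (comp j) \in D ->
    (blade j b \in D) || [exists u in D, adj u (blade j b)].
  move=> jD; apply/orP; right; apply/existsP.
  by exists (center (comp j)); rewrite jD /= eqxx.
case=> [i'|[j b]]; first by rewrite orbC; apply: dom_center.
have [ji|ji] := eqVneq (comp j) i; first by apply: dom_comp; rewrite ji.
have [|c] := hit j; first by rewrite !inE.
by rewrite /f; case: ifP => _; [apply: dom_comp | apply: dom_blade].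
Qed.

End Windmills.

(** * Realization with two large components *)

(** One triangle per component, plus [a] extra at [ord0] and [b] extra at [ord_max]; these differ,
    as there are [n.+2] components. *)
Definition two_large_fibers a b n (p : 'I_a + 'I_b + 'I_n.+2) : 'I_n.+2 :=
  match p with
  | inl (inl _) => ord0
  | inl (inr _) => ord_max
  | inr i => i
  end.

Lemma card_two_large_fibers a b n (i : 'I_n.+2) :
  #|fiber (@two_large_fibers a b n) i| =
  (i == ord0) * a + (i == ord_max) * b + 1.
Proof.
rewrite -sum1_card (eq_bigl (fun j => two_large_fibers j == i)); last first.
  by move=> j; rewrite inE.
rewrite !big_sumType /= big_pred1_eq !(eq_sym i).
have const (J : finType) (c : bool) : \sum_(j : J | c) 1 = c * #|J|.
  by case: c; [rewrite sum1_card mul1n | rewrite big_pred0].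
by rewrite !const !card_ord.
Qed.

Section TwoLargeFibers.
Variables (a b n : nat).
Notation comp := (@two_large_fibers a b n).
Notation G := (windmill comp).

Lemma card_fiberC i : #|~: fiber comp i| =
  (i != ord0) * a + (i != ord_max) * b + n.+1.
Proof.
have := cardsC (fiber comp i); rewrite card_two_large_fibers !card_sum !card_ord.
by case: (i == ord0); case: (i == ord_max) => /=; lia.
Qed.

Lemma two_large_fibers_surj i : exists j, comp j = i.
Proof. by exists (inr i). Qed.

Lemma gamma_two_large_fibers : gamma G = n.+2.
Proof. by rewrite gamma_windmill card_ord. Qed.

Hypothesis leba : b <= a.

Lemma gamma_MB_two_large_fibers : gamma_MB G = Some (n.+2 + b).
Proof.
apply: MB_number_eq => [|k]; rewrite dominator_wins_DGame.
  apply/orP; right; apply/existsP; exists (center comp ord0); rewrite inE /= !setU0.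
  (* The selection of [center comp ord_max] is fictitious and is undone by [swinS]. *)
  have := @windmill_swin _ _ comp two_large_fibers_surj ord0 (center comp ord_max).
  rewrite card_fiberC /= addnC mul1n => win.
  by apply: swinS (win _); rewrite // subsetUl.
case/orP=> [/card_dominating|]; first by rewrite cards0 card_ord.
case: k => // k /existsP[u /andP[_ winu]].
(* Staller replies with a large center that Dominator's first move [u] missed. *)
have [i [ui lei]] : exists i, u != center comp i /\ b < #|fiber comp i|.
  have [->|u0] := eqVneq u (center comp ord0).
    by exists ord_max; rewrite card_two_large_fibers eqxx mul1n addn1 ltnS leq_addl.
  exists ord0; rewrite // card_two_large_fibers eqxx mul1n addn1 ltnS.
  by rewrite (leq_trans leba) ?leq_addr.
have [domu|ndomu] := boolP (dominating (u |: set0)).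
  by have := card_dominating domu; rewrite setU0 cards1 card_ord.
case/swinP: winu => [|[_ /(_ (center comp i))]]; first by rewrite (negbTE ndomu).
rewrite setU0 inE eq_sym => /(_ ui) /dwin_dominating_set[|D [domD sD leD]].
  exact: subsetUr.
have iD : center comp i \notin D.
  apply: contra ui => iD; rewrite eq_sym -in_set1; apply: (subsetP sD).
  by rewrite !inE iD eqxx.
have := card_dominating_avoiding domD iD.
by move: leD; rewrite cards1 card_ord; lia.
Qed.

Lemma gamma_MB'_two_large_fibers : gamma_MB' G = Some (n.+2 + a).
Proof.
apply: MB_number_eq => [|k]; rewrite dominator_wins_SGame.
  apply/swinP; right; split=> [|v _].
    by exists (center comp ord0); rewrite inE.
  rewrite setU0.
  (* Dominator takes a large center left by Staller; the worse case [ord_max] costs [1 + (a + n.+1)]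
     moves. *)
  have [i i0max iv] : exists2 i, (i == ord0) || (i == ord_max) & center comp i != v.
    have [<-|] := eqVneq (center comp ord0) v; last by exists ord0.
    by exists ord_max; rewrite ?eqxx ?orbT.
  have := windmill_swin two_large_fibers_surj iv; rewrite card_fiberC => win.
  have lek : ((i != ord0) * a + (i != ord_max) * b + n.+1).+1 <= n.+2 + a.
    by case/orP: i0max => /eqP->; rewrite eqxx; case: (_ == _) => /=; lia.
  apply: dwin_leq lek _; apply/orP; right; apply/existsP; exists (center comp i).
  by rewrite !inE iv /= setU0.
case/swinP=> [/card_dominating|]; first by rewrite cards0 card_ord.
(* Staller opens with the center of the largest component. *)
case=> _ /(_ (center comp ord0)); rewrite inE setU0 => /(_ isT).
case/dwin_dominating_set=> [|D [domD sD leD]]; first exact: sub0set.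
have iD : center comp ord0 \notin D.
  apply/negP => iD; have := subsetP sD (center comp ord0).
  by rewrite !inE iD eqxx => /(_ isT).
have := card_dominating_avoiding domD iD; rewrite card_two_large_fibers eqxx.
by move: leD; rewrite cards0 card_ord; case: (_ == _) => /=; lia.
Qed.

End TwoLargeFibers.

Theorem theorem3p1 :
  (forall G : sgraph,
     le_infty (Some (gamma G)) (gamma_MB G) /\
     le_infty (gamma_MB G) (gamma_MB' G)) /\
  (forall r s t : nat, 2 <= r -> r <= s -> s <= t ->
     exists G : sgraph,
       [/\ gamma G = r, gamma_MB G = Some s & gamma_MB' G = Some t]).
Proof.
split=> [G|[|[|n]] // s t _ lers lest].
  by split; [exact: gamma_le_MB | exact: MB_le_MB'].
have le_st : s - n.+2 <= t - n.+2 by rewrite leq_sub2r.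
exists (windmill (@two_large_fibers (t - n.+2) (s - n.+2) n)); split.
- exact: gamma_two_large_fibers.
- by rewrite gamma_MB_two_large_fibers // subnKC.
- by rewrite gamma_MB'_two_large_fibers // subnKC // (leq_trans lers).
Qed.
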